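(* Let $(\mathcal M,g)$ be a Riemannian manifold, $x\in\mathcal M$, and $\mathcal H_x:\mathrm T_x\mathcal M\to\mathrm T_x\mathcal M$ a $g_x$-self-adjoint positive semidefinite operator. Let $B\subset\mathrm T_x\mathcal M$ be a subspace with $g_x$-orthonormal basis $\{b_{x,i}\}_{i=1}^\ell$, let $\Xi\subset\mathrm T_x\mathcal M$ be an $\ell$-dimensional subspace spanned by $\{\xi_{x,i}\}_{i=1}^\ell$ (not necessarily orthogonal), let $\mathcal P_{x,B,\Xi}[v]=\sum_{i=1}^\ell\langle b_{x,i},v\rangle_x\,\xi_{x,i}$, and let $\mathcal J_{x,B,\Xi}:=\mathcal P_{x,B,\Xi}^*\mathcal H_x\mathcal P_{x,B,\Xi}:B\to B$. Let $\nu>0$, $b\in\mathrm T_x\mathcal M$, and $$u=\mathcal P_{x,B,\Xi}\,(\mathcal J_{x,B,\Xi}+\nu\,\mathrm{Id}_B)^{-1}\,\mathcal P_{x,B,\Xi}^*[b].$$ Then $$u=\sum_{i=1}^\ell\bigl((\mathbf Q+\nu\mathbf I)^{-1}a\bigr)_i\,\xi_{x,i},$$ where $\mathbf Q\in\mathbb R^{\ell\times\ell}$ and $a\in\mathbb R^\ell$ are given by $\mathbf Q_{ij}=\langle\xi_{x,i},\mathcal H_x[\xi_{x,j}]\rangle_x$ and $a_i=\langle\xi_{x,i},b\rangle_x$, $i,j=1,\dots,\ell$.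
   Context: $\langle\cdot,\cdot\rangle_x$ is the inner product on $\mathrm T_x\mathcal M$ given by $g_x$; adjoints ($^*$), self-adjointness and positive semidefiniteness are with respect to it. The adjoint of $\mathcal P_{x,B,\Xi}$ is $\mathcal P_{x,B,\Xi}^*[u]=\sum_{i=1}^\ell\langle\xi_{x,i},u\rangle_x\,b_{x,i}$, which takes values in $B$. $\mathbf I$ is the $\ell\times\ell$ identity matrix. *)

(* Defs.v *)
From HB Require Import structures.
From mathcomp Require Import all_boot all_order all_algebra.
From mathcomp Require Import sesquilinear.
From mathcomp Require Import all_classical all_reals all_analysis.

Set Implicit Arguments.
Unset Strict Implicit.
Unset Printing Implicit Defensive.

Import Order.TTheory GRing.Theory Num.Theory.
Import numFieldNormedType.Exports.

Local Open Scope classical_set_scope.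
Local Open Scope ring_scope.

(* Meant for open [U] and finite-dimensional [V]: there, [f] is of class C^(k+1)
   iff it is differentiable and all its directional derivatives are C^k. *)
Fixpoint class_C (R : realType) (V W : normedModType R) (k : nat) (U : set V)
    (f : V -> W) : Prop :=
  match k with
  | 0%N => forall y, U y -> {for y, continuous f}
  | k'.+1 => (forall y, U y -> differentiable f y) /\
             (forall v : V, class_C k' U (fun y => 'D_v f y))
  end.

Definition smooth_on (R : realType) (V W : normedModType R) (U : set V)
    (f : V -> W) : Prop := forall k, class_C k U f.

Lemma diff_comp_near (R : realType) (U V W : normedModType R) (f : U -> V)
    (g : V -> W) (h : U -> W) x y w :
  f x = y -> differentiable f x -> differentiable g y -> differentiable h x ->
  (\forall z \near x, g (f z) = h z) -> 'd g y ('d f x w) = 'd h x w.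
Proof.
move=> <- df dg dh fgh; rewrite -(deriveE w dh) -(near_eq_derive _ fgh).
rewrite -[fun z => _]/(g \o f) (deriveE w (differentiable_comp df dg)).
by rewrite (diff_comp df dg).
Qed.

(* [chart i] and [chart_inv i] are total functions; only their values on
   [chart_dom i] and on its image are meaningful. *)
Record manifold (R : realType) (n : nat) := Manifold {
  manifold_carrier :> topologicalType;
  manifold_hausdorff : hausdorff_space manifold_carrier;
  manifold_second_countable : @second_countable manifold_carrier;
  chart_index : Type;
  chart_dom : chart_index -> set manifold_carrier;
  chart : chart_index -> manifold_carrier -> 'rV[R]_n;
  chart_inv : chart_index -> 'rV[R]_n -> manifold_carrier;
  chart_dom_open : forall i, open (chart_dom i);
  chart_cover : forall x, exists i, chart_dom i x;
  chart_image_open : forall i, open (chart i @` chart_dom i);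
  chartK : forall i x, chart_dom i x -> chart_inv i (chart i x) = x;
  chart_continuous : forall i x, chart_dom i x -> {for x, continuous (chart i)};
  chart_inv_continuous : forall i y, (chart i @` chart_dom i) y ->
    {for y, continuous (chart_inv i)};
  chart_transition_smooth : forall i j,
    smooth_on (chart i @` (chart_dom i `&` chart_dom j))
      (chart j \o chart_inv i)
}.

Section Tangent.
Variables (R : realType) (n : nat) (M : manifold R n).
Implicit Types (i j k : chart_index M) (x : M).

Definition transition i j : 'rV[R]_n -> 'rV[R]_n := chart j \o chart_inv i.

(* A tangent vector at [x] is the family of its coordinate vectors in the charts
   around [x], two of which are related by the differential of the transition
   map; the entries at charts that do not contain [x] are set to 0. *)
Definition is_tangent x (c : chart_index M -> 'rV[R]_n) : Prop :=
  (forall i, ~ chart_dom i x -> c i = 0) /\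
  (forall i j, chart_dom i x -> chart_dom j x ->
     c j = 'd (transition i j) (chart i x) (c i)).

Definition tangent_pred x : {pred chart_index M -> 'rV[R]_n} :=
  fun c => `[< is_tangent x c >].

Record tangent x := Tangent {
  tangent_coord : chart_index M -> 'rV[R]_n;
  tangent_coordP : tangent_coord \in tangent_pred x }.

HB.instance Definition _ x := [isSub for @tangent_coord x].
HB.instance Definition _ x := [Choice of tangent x by <:].

Lemma tangent_submod_closed x : submod_closed (tangent_pred x).
Proof.
split=> [|a u v /asboolP[u0 uE] /asboolP[v0 vE]]; apply/asboolP; split=> //.
- by move=> i j _ _; rewrite linear0.
- by move=> i ix; rewrite /= [LHS](_ : _ = a *: u i + v i)// u0// v0// scaler0 addr0.
- move=> i j ix jx.
  rewrite [LHS](_ : _ = a *: u j + v j)// [X in _ = 'd _ _ X](_ : _ = a *: u i + v i)//.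
  by rewrite linearP -uE// -vE.
Qed.

HB.instance Definition _ x := GRing.isSubmodClosed.Build R
  (chart_index M -> 'rV[R]_n) (tangent_pred x) (tangent_submod_closed x).
HB.instance Definition _ x := [SubChoice_isSubLmodule of tangent x by <:].

Lemma transition_open i j : open (chart i @` (chart_dom i `&` chart_dom j)).
Proof.
rewrite openE => _ [x [ix jx] <-].
have ci : (chart i @` chart_dom i) (chart i x) by exists x.
have di := chart_inv_continuous ci.
have : nbhs (chart i x) (chart_inv i @^-1` chart_dom j).
  by apply: di; rewrite chartK//; apply: open_nbhs_nbhs; split=> //; exact: chart_dom_open.
have : nbhs (chart i x) (chart i @` chart_dom i).
  by apply: open_nbhs_nbhs; split=> //; exact: chart_image_open.
move=> A B; near=> y.
have [z iz zy] : (chart i @` chart_dom i) y by near: y.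
exists z => //; split=> //; rewrite -(chartK iz) zy.
have : (chart_inv i @^-1` chart_dom j) y by near: y.
by [].
Unshelve. all: by end_near. Qed.

Lemma transition_differentiable i j x : chart_dom i x -> chart_dom j x ->
  differentiable (transition i j) (chart i x).
Proof.
move=> ix jx; have [+ _] := chart_transition_smooth i j 1.
by apply; exists x.
Qed.

Lemma transition_cocycle i j k x (w : 'rV[R]_n) :
  chart_dom i x -> chart_dom j x -> chart_dom k x ->
  'd (transition j k) (chart j x) ('d (transition i j) (chart i x) w) =
  'd (transition i k) (chart i x) w.
Proof.
move=> ix jx kx; apply: diff_comp_near.
- by rewrite /transition /= chartK.
- exact: transition_differentiable.
- exact: transition_differentiable.
- exact: transition_differentiable.
have : nbhs (chart i x) (chart i @` (chart_dom i `&` chart_dom j)).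
  by apply: open_nbhs_nbhs; split; [exact: transition_open|exists x].
apply: filterS => _ [z [iz jz] <-].
by rewrite /transition /= chartK// chartK.
Qed.

(* The vector of coordinates [w] in the chart [i]; it is 0 if [i] does not
   contain [x]. *)
Definition tangent_of_coord_fun i x (w : 'rV[R]_n) :
    chart_index M -> 'rV[R]_n :=
  fun j => if `[< chart_dom i x /\ chart_dom j x >] then
             'd (transition i j) (chart i x) w else 0.

Lemma tangent_of_coordP i x w : tangent_of_coord_fun i x w \in tangent_pred x.
Proof.
apply/asboolP; split=> [j jx|j k jx kx]; rewrite /tangent_of_coord_fun.
  by case: asboolP => // -[].
case: asboolP => [[ix _]|nik]; case: asboolP => [[? ?]|nij].
- by symmetry; apply: transition_cocycle.
- by case: nij; split.
- by case: nik; split.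
- by rewrite linear0.
Qed.

Definition tangent_of_coord i x (w : 'rV[R]_n) : tangent x :=
  Tangent (tangent_of_coordP i x w).

Lemma tangent_of_coordK i x (w : 'rV[R]_n) : chart_dom i x ->
  tangent_coord (tangent_of_coord i x w) i = w.
Proof.
move=> ix; rewrite /= /tangent_of_coord_fun; case: asboolP => [_|[]//].
rewrite -(deriveE w (transition_differentiable ix ix)).
have fE : \forall y \near chart i x, transition i i y = id y.
  have : nbhs (chart i x) (chart i @` chart_dom i).
    by apply: open_nbhs_nbhs; split; [exact: chart_image_open|exists x].
  by apply: filterS => _ [z iz <-]; rewrite /transition /= chartK.
by rewrite (near_eq_derive _ fE) derive_id.
Qed.

Lemma tangent_coordK i x (v : tangent x) : chart_dom i x ->
  tangent_of_coord i x (tangent_coord v i) = v.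
Proof.
move=> ix; apply: val_inj; apply/funext => j /=.
have /asboolP[v0 vE] := tangent_coordP v.
rewrite /tangent_of_coord_fun; case: asboolP => [[_ jx]|nj].
  by rewrite -vE.
by rewrite v0// => jx; apply: nj.
Qed.

Lemma tangent_vector_axiom x : Vector.axiom n (tangent x).
Proof.
have [i ix] := cid (chart_cover x).
exists (fun v => tangent_coord v i); first by move=> a u v.
exists (tangent_of_coord i x); first by move=> v; exact: tangent_coordK.
by move=> w; exact: tangent_of_coordK.
Qed.

HB.instance Definition _ x :=
  Lmodule_hasFinDim.Build R (tangent x) (tangent_vector_axiom x).

End Tangent.

(* Smoothness is that of the metric coefficients in every chart, polarized over
   all constant coordinate vectors [v] and [w]. *)
Record riemannian_manifold (R : realType) (n : nat) := RiemannianManifold {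
  riemannian_base :> manifold R n;
  metric : forall x : riemannian_base, {dot (tangent x) for (@idfun R)};
  metric_smooth : forall (i : chart_index riemannian_base) (v w : 'rV[R]_n),
    @smooth_on R 'rV[R]_n R^o (chart i @` chart_dom i)
      (fun y => let x := chart_inv i y in
         metric x (tangent_of_coord i x v) (tangent_of_coord i x w))
}.

Section Operators.
Variables (R : realType) (V : vectType R) (g : {dot V for (@idfun R)}).
Implicit Types (B : {vspace V}) (u v : V).

Definition self_adjoint (H : 'End(V)) : Prop :=
  forall u v, g (H u) v = g u (H v).

Definition positive_semidefinite (H : 'End(V)) : Prop :=
  forall v, 0 <= g v (H v).

Definition orthonormal_basis_of l B (b : l.-tuple V) : Prop :=
  basis_of B b /\ forall i j : 'I_l, g (tnth b i) (tnth b j) = (i == j)%:R.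

(* [B] carries the inner product inherited from [V]. *)
Definition is_adjoint B (f : 'Hom(subvs_of B, V)) (h : 'Hom(V, subvs_of B)) :
    Prop :=
  forall (w : subvs_of B) u, g (f w) u = g (vsval w) (vsval (h u)).

(* The adjoint is unique ([adjointE]); for the maps [subspace_map] below it
   exists and is computed in [subspace_map_adjointE]. *)
Definition adjoint B (f : 'Hom(subvs_of B, V)) : 'Hom(V, subvs_of B) :=
  xget 0 [set h | is_adjoint f h].

Definition subspace_map_fun l B (b xi : l.-tuple V) (w : subvs_of B) : V :=
  \sum_(i < l) g (tnth b i) (vsval w) *: tnth xi i.

Lemma subspace_map_fun_is_linear l B (b xi : l.-tuple V) :
  linear (@subspace_map_fun l B b xi).
Proof.
move=> a u v; rewrite /subspace_map_fun scaler_sumr -big_split /=.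
by apply: eq_bigr => i _; rewrite !linearP /= scalerDl scalerA.
Qed.

HB.instance Definition _ l B (b xi : l.-tuple V) :=
  GRing.isLinear.Build R (subvs_of B) V _ (@subspace_map_fun l B b xi)
    (@subspace_map_fun_is_linear l B b xi).

Definition subspace_map l B (b xi : l.-tuple V) : 'Hom(subvs_of B, V) :=
  linfun (@subspace_map_fun l B b xi).

Definition subspace_operator l B (b xi : l.-tuple V) (H : 'End(V)) :
    'End(subvs_of B) :=
  let P := subspace_map B b xi in (adjoint P \o H \o P)%VF.

Lemma dot_sym u v : g u v = g v u.
Proof. by rewrite (@hermitian_subproof _ _ _ _ g) expr0 mul1r. Qed.

Lemma dotZr a u v : g u (a *: v) = a * g u v.
Proof. by have := @linearr_subproof _ _ _ _ _ _ g u a v. Qed.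

Lemma dot_eq0 v : g v v = 0 -> v = 0.
Proof.
by move=> gv; apply/eqP/negPn/negP => /(neq0_dnorm_gt0 (s := g)); rewrite gv ltxx.
Qed.

Lemma adjointE B (f : 'Hom(subvs_of B, V)) h : is_adjoint f h -> adjoint f = h.
Proof.
move=> fh; rewrite /adjoint; case: xgetP => [k _ fk|/(_ h)//].
apply/lfunP => u; apply/eqP; rewrite -subr_eq0; apply/eqP/val_inj/dot_eq0.
have E (w : subvs_of B) : g (vsval w) (vsval (k u - h u)) = 0.
  by rewrite !linearB /= -fk -fh subrr.
exact: E.
Qed.

Lemma subspace_map_adjointE l B (b xi : l.-tuple V) u :
  orthonormal_basis_of B b ->
  vsval (adjoint (subspace_map B b xi) u) =
  \sum_(i < l) g (tnth xi i) u *: tnth b i.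
Proof.
move=> [bB _].
have inB i : tnth b i \in B by apply: (basis_mem bB); exact: mem_tnth.
pose F u := vsproj B (\sum_(i < l) g (tnth xi i) u *: tnth b i).
have FE v : vsval (F v) = \sum_(i < l) g (tnth xi i) v *: tnth b i.
  by rewrite /F vsprojK// rpred_sum// => i _; rewrite rpredZ.
have Flin : linear F.
  move=> a v w; apply: val_inj.
  have E (y z : subvs_of B) : vsval (a *: y + z) = a *: vsval y + vsval z.
    by rewrite linearP.
  rewrite -[LHS]/(vsval _) -[RHS]/(vsval _) E !FE.
  rewrite scaler_sumr -big_split /=.
  by apply: eq_bigr => i _; rewrite linearP /= scalerDl scalerA.
pose FL : {linear V -> subvs_of B} :=
  HB.pack F (GRing.isLinear.Build R V (subvs_of B) _ F Flin).
have FLE v : vsval (linfun FL v) = \sum_(i < l) g (tnth xi i) v *: tnth b i.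
  by rewrite lfunE; exact: FE.
rewrite (@adjointE _ _ (linfun FL)) ?FLE// => w v.
rewrite FLE lfunE dot_sym /= /subspace_map_fun.
rewrite !(raddf_sum (g _)).
apply: eq_bigr => i _; rewrite /= !dotZr (dot_sym v) (dot_sym (vsval w)).
by rewrite mulrC.
Qed.

End Operators.

(* Main.v *)
(* In the orthonormal basis b, the coordinate map y |-> \sum_i y_i b_i from R^l
   to B intertwines Q + nu I with J + nu Id and turns P into y |-> \sum_i y_i xi_i
   and P^* c into a. Since <w, (J + nu) w> = <P w, H (P w)> + nu <w, w>, the
   operator J + nu Id is injective, hence so is Q + nu I. *)
Require Import Defs.
From mathcomp Require Import all_boot all_order all_algebra.
From mathcomp Require Import sesquilinear.
From mathcomp Require Import all_classical all_reals all_analysis.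
From mathcomp Require Import lra.

Set Implicit Arguments.
Unset Strict Implicit.
Unset Printing Implicit Defensive.

Import Order.TTheory GRing.Theory Num.Theory.
Import numFieldNormedType.Exports.

Local Open Scope ring_scope.

(** [adjoint] is a choice with default 0; the explicit formula for it makes both sides equal to the
    sum of the products [<b_i, w> <xi_i, v>], so the choice is a genuine adjoint. *)
Lemma subspace_map_is_adjoint (R : realType) (V : vectType R)
    (g : {dot V for (@idfun R)}) (l : nat) (B : {vspace V}) (b xi : l.-tuple V) :
  orthonormal_basis_of g B b ->
  is_adjoint g (subspace_map g B b xi) (adjoint g (subspace_map g B b xi)).
Proof.
move=> bB w v; rewrite subspace_map_adjointE// lfunE /= /subspace_map_fun.
rewrite dot_sym !(raddf_sum (g _)); apply: eq_bigr => i _ /=.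
by rewrite !dotZr (dot_sym g v) (dot_sym g (vsval w)) mulrC.
Qed.

Lemma lker0_subspace_operator_shift (R : realType) (V : vectType R)
    (g : {dot V for (@idfun R)}) (l : nat) (B : {vspace V}) (b xi : l.-tuple V)
    (H : 'End(V)) (nu : R) :
  orthonormal_basis_of g B b -> positive_semidefinite g H -> 0 < nu ->
  lker (subspace_operator g B b xi H + nu *: \1%VF) == 0%VS.
Proof.
move=> bB Hpsd nu0; rewrite -subv0; apply/subvP => w.
rewrite memv_ker memv0 add_lfunE scale_lfunE id_lfunE !comp_lfunE => /eqP mw0.
have := congr1 (fun z => g (vsval w) (vsval z)) mw0.
(* Moving the adjoint to the left factor turns the first summand into [<P w, H (P w)>], to which
   positive semidefiniteness applies. *)
rewrite !linearD /= -subspace_map_is_adjoint// dotZr raddf0.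
set p := g _ _ => E.
have p0 : 0 <= p by exact: Hpsd.
case: (eqVneq (vsval w) 0) => [w0|/(neq0_dnorm_gt0 (s := g)) gw0].
  by apply/eqP/val_inj; rewrite /= w0.
by have := mulr_gt0 nu0 gw0; lra.
Qed.

Lemma dot_orthonormal_comb (R : realType) (V : vectType R)
    (g : {dot V for (@idfun R)}) (l : nat) (B : {vspace V}) (b : l.-tuple V)
    (y : 'cV[R]_l) (i : 'I_l) :
  orthonormal_basis_of g B b ->
  g (tnth b i) (\sum_(j < l) y j 0 *: tnth b j) = y i 0.
Proof.
move=> [_ bon]; rewrite (raddf_sum (g _)) (bigD1 i)//= big1 => [|j ji].
  by rewrite dotZr bon eqxx mulr1 addr0.
by rewrite dotZr bon eq_sym (negbTE ji) mulr0.
Qed.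

Lemma subspace_map_comb (R : realType) (V : vectType R)
    (g : {dot V for (@idfun R)}) (l : nat) (B : {vspace V}) (b xi : l.-tuple V)
    (w : subvs_of B) (y : 'cV[R]_l) :
  orthonormal_basis_of g B b -> vsval w = \sum_(i < l) y i 0 *: tnth b i ->
  subspace_map g B b xi w = \sum_(i < l) y i 0 *: tnth xi i.
Proof.
move=> bB wE; rewrite lfunE /= /subspace_map_fun wE.
by apply: eq_bigr => i _; rewrite (dot_orthonormal_comb _ _ bB).
Qed.

(** The [i]-th coordinate of [P^* (H (P w))] is [<xi_i, H (P w)>]; expanding [P w] as the sum of the
    [y_j xi_j] gives row [i] of [Q y]. *)
Lemma subspace_operator_shift_comb (R : realType) (V : vectType R)
    (g : {dot V for (@idfun R)}) (l : nat) (B : {vspace V}) (b xi : l.-tuple V)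
    (H : 'End(V)) (nu : R) (w : subvs_of B) (y : 'cV[R]_l) :
  orthonormal_basis_of g B b -> vsval w = \sum_(i < l) y i 0 *: tnth b i ->
  vsval ((subspace_operator g B b xi H + nu *: \1%VF)%R w) =
  \sum_(i < l) (((\matrix_(i, j) g (tnth xi i) (H (tnth xi j))) + nu%:M) *m y) i 0
    *: tnth b i.
Proof.
move=> bB wE; rewrite add_lfunE scale_lfunE id_lfunE !comp_lfunE.
rewrite linearD linearZ /= subspace_map_adjointE// (subspace_map_comb xi bB wE) wE.
rewrite scaler_sumr -big_split /=; apply: eq_bigr => i _.
rewrite scalerA -scalerDl mulmxDl mul_scalar_mx !mxE; congr ((_ + _) *: _).
rewrite linear_sum (raddf_sum (g _)); apply: eq_bigr => j _ /=.
by rewrite linearZ /= dotZr mxE mulrC.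
Qed.

(** Inverses of linear maps and of matrices are total operations here; the first two conjuncts
    certify that both are true inverses. *)
Theorem proposition3p3 (R : realType) (n : nat) (M : riemannian_manifold R n)
    (x : M) (H : 'End(tangent x))
    (H_self_adjoint : self_adjoint (metric x) H)
    (H_psd : positive_semidefinite (metric x) H)
    (l : nat) (B Xi : {vspace tangent x}) (b xi : l.-tuple (tangent x))
    (b_basis : orthonormal_basis_of (metric x) B b)
    (Xi_dim : \dim Xi = l) (Xi_span : Xi = <<xi>>%VS)
    (nu : R) (nu_gt0 : 0 < nu) (c : tangent x) :
  let g := metric x in
  let P := subspace_map g B b xi in
  let J := subspace_operator g B b xi H in
  let u := P ((J + nu *: \1)^-1 (adjoint g P c))%VF in
  let Q : 'M[R]_l := \matrix_(i, j) g (tnth xi i) (H (tnth xi j)) in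
  let a : 'cV[R]_l := \col_i g (tnth xi i) c in
  [/\ lker (J + nu *: \1%VF) == 0%VS,
      Q + nu%:M \in unitmx &
      u = \sum_(i < l) (invmx (Q + nu%:M) *m a) i 0 *: tnth xi i].
Proof.
move=> g P J u Q a.
have ker0 : lker (J + nu *: \1%VF) == 0%VS by exact: lker0_subspace_operator_shift.
have bmem i : tnth b i \in B by apply: (basis_mem b_basis.1); exact: mem_tnth.
(* The coordinate map into [B]; the sum already lies in [B], so [vsproj] only changes its type. *)
pose beta (y : 'cV[R]_l) := vsproj B (\sum_(i < l) y i 0 *: tnth b i).
have betaE y : vsval (beta y) = \sum_(i < l) y i 0 *: tnth b i.
  by rewrite vsprojK// rpred_sum// => i _; rewrite rpredZ.
have betaM y : (J + nu *: \1%VF)%R (beta y) = beta ((Q + nu%:M) *m y).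
  apply: val_inj; rewrite /= betaE.
  exact: (subspace_operator_shift_comb xi H nu b_basis (betaE y)).
have beta_inj y z : beta y = beta z -> y = z.
  move=> yz; apply/colP => i.
  by rewrite -!(dot_orthonormal_comb _ i b_basis) -!betaE yz.
have Qunit : Q + nu%:M \in unitmx.
  (* Row freeness concerns row vectors, hence the transposes. By [betaM], [beta] sends the kernel of
     [Q + nu I] into that of [J + nu Id]. *)
  rewrite -unitmx_tr -row_free_unit; apply/inj_row_free => v vQ0.
  have Qv0 : (Q + nu%:M) *m v^T = 0 by rewrite -[LHS]trmxK trmx_mul trmxK vQ0 trmx0.
  apply/trmx_inj/beta_inj/(lker0P ker0).
  by rewrite !betaM Qv0 trmx0 mulmx0.
split=> //; rewrite {}/u.
(* Since [P^* c] is [beta a], it is exhibited as an image under [J + nu Id], which the inverse then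
   cancels. *)
have -> : adjoint g P c = (J + nu *: \1%VF)%R (beta (invmx (Q + nu%:M) *m a)).
  rewrite betaM mulKVmx//; apply: val_inj; rewrite /= betaE subspace_map_adjointE//.
  by apply: eq_bigr => i _; rewrite mxE.
by rewrite lker0_lfunK// (subspace_map_comb xi b_basis (betaE _)).
Qed.
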